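(* Let $\mathcal A$ be an S-ring over a finite cyclic group $G$. Suppose that an $\mathcal A$-group $H$ has an $\mathcal A$-complement and that $\mathcal A_S=\mathbb Z S$ for some $\mathcal A$-section $S$ projectively equivalent to $G/H$. Then for every $\mathcal A$-section $T$ projectively equivalent to $H/1$, the S-ring $\mathcal A$ is Cayley isomorphic to $\mathcal A_S\otimes\mathcal A_T$.
   Context: An S-ring over a finite group $G$ is a subring $\mathcal A$ of $\mathbb Z G$ spanned by the sums $\underline X=\sum_{x\in X}x$ over the blocks $X$ of a partition of $G$ (basic sets) containing $\{e\}$ and closed under $X\mapsto X^{-1}$. An $\mathcal A$-group is a subgroup that is a union of basic sets; an $\mathcal A$-section is $U/L$ with $L\le U$ $\mathcal A$-groups, with restriction $\mathcal A_{U/L}$ the S-ring over $U/L$ whose basic sets are the images of basic sets contained in $U$. $\mathcal A_S=\mathbb ZS$ means that all basic sets of $\mathcal A_S$ are singletons. An $\mathcal A$-complement of an $\mathcal A$-group $H$ is an $\mathcal A$-group $H'$ with $G=H\times H'$. Projective equivalence of $\mathcal A$-sections is the equivalence relation generated by the relation $U_1/L_1\to U_2/L_2$ holding when $U_1\cap L_2=L_1$ and $U_1L_2=U_2$. For S-rings $\mathcal A_1$ over $G_1$ and $\mathcal A_2$ over $G_2$, $\mathcal A_1\otimes\mathcal A_2$ is the S-ring over $G_1\times G_2$ with basic sets $X_1\times X_2$, $X_i$ basic sets of $\mathcal A_i$. S-rings $\mathcal A$ over $G$ and $\mathcal A'$ over $G'$ are Cayley isomorphic if some group isomorphism $G\to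 G'$ maps the basic sets of $\mathcal A$ onto the basic sets of $\mathcal A'$. *)

(* Defs.v *)
From HB Require Import structures.
From mathcomp Require Import all_boot all_order all_algebra all_fingroup.
From mathcomp Require Import all_solvable.
From Stdlib Require Import Relations.Relation_Operators.

Set Implicit Arguments.
Unset Strict Implicit.
Unset Printing Implicit Defensive.

Import GRing.Theory.
Local Open Scope group_scope.

(* The group ring Z[gT], with the convolution product.  For G : {group gT},  *)
(* ZG is the subring of the functions supported on G.                        *)
Definition zgring (gT : finGroupType) := {ffun gT -> int}.
HB.instance Definition _ (gT : finGroupType) :=
  GRing.Zmodule.copy (zgring gT) {ffun gT -> int}.

Section GroupRing.
Local Open Scope ring_scope.
Variable gT : finGroupType.
Implicit Types f g h : zgring gT.

Definition zgring_one : zgring gT := [ffun x => (x == 1%g)%:R].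
Definition zgring_mul f g : zgring gT :=
  [ffun z => \sum_(x : gT) f x * g (x^-1 * z)%g].

Fact zgring_mulA : associative zgring_mul.
Proof.
move=> f g h; apply/ffunP=> z; rewrite !ffunE.
under [RHS]eq_bigr => y _ do rewrite ffunE mulr_suml.
rewrite exchange_big; apply: eq_bigr => x _ /=.
rewrite ffunE mulr_sumr (reindex_inj (mulgI x^-1%g)) /=.
apply: eq_bigr => y _; rewrite mulrA; congr (_ * h _).
by rewrite invMg invgK -!mulgA mulKVg.
Qed.

Fact zgring_mul1r : left_id zgring_one zgring_mul.
Proof.
move=> f; apply/ffunP=> z; rewrite ffunE (bigD1 1%g) //= ffunE eqxx mul1r.
rewrite invg1 mul1g big1 ?addr0 // => x /negPf x1.
by rewrite ffunE x1 mul0r.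
Qed.

Fact zgring_mulr1 : right_id zgring_one zgring_mul.
Proof.
move=> f; apply/ffunP=> z; rewrite ffunE (bigD1 z) //= ffunE mulVg eqxx mulr1.
rewrite big1 ?addr0 // => x xz; rewrite ffunE -eq_mulVg1 (negPf xz).
by rewrite mulr0.
Qed.

Fact zgring_mulDl : left_distributive zgring_mul +%R.
Proof.
move=> f g h; apply/ffunP=> z; rewrite !ffunE -big_split /=.
by apply: eq_bigr => x _; rewrite ffunE mulrDl.
Qed.

Fact zgring_mulDr : right_distributive zgring_mul +%R.
Proof.
move=> f g h; apply/ffunP=> z; rewrite !ffunE -big_split /=.
by apply: eq_bigr => x _; rewrite ffunE mulrDr.
Qed.

HB.instance Definition _ := GRing.Zmodule_isPzRing.Build (zgring gT)
  zgring_mulA zgring_mul1r zgring_mulr1 zgring_mulDl zgring_mulDr.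

(* \underline X, i.e. the sum in Z[gT] of the elements of X. *)
Definition set_sum (X : {set gT}) : zgring gT := [ffun x => (x \in X)%:R].

End GroupRing.

Section SRings.
Variable gT : finGroupType.
Implicit Types (G H K U L : {group gT}) (A : {set {set gT}}) (S T : section gT).

(* An S-ring over G is given by the partition A of G into its basic sets;    *)
(* the ring itself is the Z-span B of the sums of the basic sets.            *)
Definition Sring G A : Prop :=
  [/\ partition A G,
      [set 1] \in A,
      {in A, forall X, X^-1 \in A}
    & exists2 B : {pred zgring gT}, GRing.subring_closed B &
        forall f, f \in B <->
          exists c : {set gT} -> int, f = (\sum_(X in A) set_sum X *~ c X)%R].

Definition Agroup A U : Prop :=
  exists2 B : {set {set gT}}, B \subset A & U = cover B :> {set gT}.

(* A section U / L is the pair (S.1, S.2) = (U, L); normality of L in U is   *)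
(* automatic over an abelian group.                                          *)
Definition Asection A S : Prop :=
  [/\ Agroup A S.1, Agroup A S.2 & S.2 <| S.1].

Definition restr A S : {set {set coset_of S.2}} :=
  [set (X / S.2 : {set coset_of S.2}) | X : {set gT} in A & X \subset S.1].

(* For A := restr A S this is the condition A_S = Z S.                       *)
Definition discrete A : Prop := {in A, forall X, exists x, X = [set x]}.

Definition Acomplement G A H K : Prop := Agroup A K /\ H \x K = G.

Definition proj_step A S T : Prop :=
  [/\ Asection A S, Asection A T,
      S.1 :&: T.2 = S.2 :> {set gT} & S.1 * T.2 = T.1 :> {set gT}].

Definition proj_equiv A : section gT -> section gT -> Prop :=
  clos_refl_sym_trans (section gT) (proj_step A).

End SRings.

Definition tensor (gT1 gT2 : finGroupType)
    (A1 : {set {set gT1}}) (A2 : {set {set gT2}}) : {set {set gT1 * gT2}} :=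
  [set setX X1 X2 | X1 in A1, X2 in A2].

Definition Cayley_isomorphic (gT rT : finGroupType)
    (G : {group gT}) (A : {set {set gT}})
    (G' : {group rT}) (A' : {set {set rT}}) : Prop :=
  exists2 f : {morphism G >-> rT}, isom G G' f &
    [set f @* X | X : {set gT} in A] = A'.

(* Main.v *)
(** A product of two [A]-sets (unions of basic sets) is an [A]-set: the
    coefficients of the product of their sums are constant on basic sets and
    vanish exactly outside the product. Hence an elementary projective
    equivalence [U1/L1 -> U2/L2] is realised by the second isomorphism theorem
    as a Cayley isomorphism: every basic set in [U2 = U1 L2] has the same image
    modulo [L2] as some basic set in [U1]. With [K] a complement of [H], the
    section [S] is equivalent to [K/1], so the basic sets inside [K] are
    singletons; translation by elements of [K] then permutes the basic sets, and
    every basic set is [k Y] with [k] in [K] and [Y] a basic set inside [H]. *)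
Require Import Defs.
From mathcomp Require Import all_boot all_order all_algebra all_fingroup.
From mathcomp Require Import all_solvable.
From Stdlib Require Import Relations.Relation_Operators.

Local Open Scope group_scope.

(** * Cayley isomorphism: symmetry, transitivity, discreteness and tensor products *)

Lemma Cayley_sym (gT rT : finGroupType) (G : {group gT}) (A : {set {set gT}})
    (G' : {group rT}) (A' : {set {set rT}}) :
  {in A, forall X : {set gT}, X \subset G} ->
  Cayley_isomorphic G A G' A' -> Cayley_isomorphic G' A' G A.
Proof.
move=> sAG [f isof <-]; have [injf defG'] := isomP isof.
exists (isom_inv isof); first exact: isom_sym.
apply/setP=> X; apply/imsetP/idP => [[_ /imsetP[Y AY ->] ->] | AX].
  (* The image under a morphism ignores whatever lies outside its domain, so this inclusion is what
     lets the inverse recover [Y]. *)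
  have sYG := sAG _ AY.
  rewrite morphim_restrm (setIidPr _) ?morphim_invm //.
  by rewrite -defG' morphimS.
exists (f @* X); first exact: imset_f.
have sXG := sAG _ AX.
by rewrite morphim_restrm (setIidPr _) ?morphim_invm // -defG' morphimS.
Qed.

Lemma Cayley_trans (gT rT qT : finGroupType)
    (G : {group gT}) (A : {set {set gT}})
    (G' : {group rT}) (A' : {set {set rT}})
    (G'' : {group qT}) (A'' : {set {set qT}}) :
  Cayley_isomorphic G A G' A' -> Cayley_isomorphic G' A' G'' A'' ->
  Cayley_isomorphic G A G'' A''.
Proof.
move=> [f isof <-] [g isog <-].
have [[injf defG'] [injg defG'']] := (isomP isof, isomP isog).
(* The composite has domain [f @*^-1 G']; it is restricted to [G] to get a morphism of the required
   type. *)
have sG : G \subset f @*^-1 G' by rewrite -sub_morphim_pre ?defG'.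
exists (restrm_morphism sG (comp_morphism f g)) => /=.
  apply: sub_isom => //.
    by rewrite morphim_restrm setIid morphim_comp defG'.
  by apply: injm_restrm; apply: injm_comp.
rewrite -imset_comp; apply: eq_imset => X /=.
by rewrite morphim_restrm morphim_comp morphimIdom.
Qed.

Lemma Cayley_discrete (gT rT : finGroupType) (G : {group gT}) (A : {set {set gT}})
    (G' : {group rT}) (A' : {set {set rT}}) :
  {in A, forall X : {set gT}, X \subset G} ->
  Cayley_isomorphic G A G' A' -> discrete A -> discrete A'.
Proof.
move=> sAG [f _ <-] dA _ /imsetP[X AX ->].
have sXG := sAG _ AX; have [x defX] := dA X AX; exists (f x).
by rewrite defX morphim_set1 // -sub1set -defX.
Qed.

Lemma Cayley_tensor (gT1 gT2 rT1 rT2 : finGroupType)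
    (G1 : {group gT1}) (A1 : {set {set gT1}})
    (G2 : {group gT2}) (A2 : {set {set gT2}})
    (G1' : {group rT1}) (A1' : {set {set rT1}})
    (G2' : {group rT2}) (A2' : {set {set rT2}}) :
  {in A1, forall X : {set gT1}, X \subset G1} ->
  {in A2, forall X : {set gT2}, X \subset G2} ->
  Cayley_isomorphic G1 A1 G1' A1' -> Cayley_isomorphic G2 A2 G2' A2' ->
  Cayley_isomorphic (setX_group G1 G2) (tensor A1 A2)
    (setX_group G1' G2') (tensor A1' A2').
Proof.
move=> sA1 sA2 [f isof <-] [g isog <-].
have [[injf defG1] [injg defG2]] := (isomP isof, isomP isog).
pose h (x : gT1 * gT2) := (f x.1, g x.2).
have hM : {in setX_group G1 G2 &, {morph h : x y / x * y}}.
  move=> [x1 x2] [y1 y2] /setXP[Gx1 Gx2] /setXP[Gy1 Gy2].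
  by rewrite /h /= !morphM.
have hX (X1 : {set gT1}) (X2 : {set gT2}) :
    X1 \subset G1 -> X2 \subset G2 ->
  Morphism hM @* setX X1 X2 = setX (f @* X1) (g @* X2).
  move=> sX1 sX2; rewrite !morphimEsub //=; last exact: setXS.
  apply/setP=> [[y1 y2]]; rewrite inE /=; apply/imsetP/andP.
    by case=> [[x1 x2] /setXP[X1x X2x] [-> ->]]; rewrite !imset_f.
  case=> /imsetP[x1 Xx1 ->] /imsetP[x2 Xx2 ->].
  by exists (x1, x2); first exact/setXP.
exists (Morphism hM).
  apply/isomP; split; last by rewrite /= hX // defG1 defG2.
  apply/injmP=> [[x1 x2] [y1 y2]] /setXP[Gx1 Gx2] /setXP[Gy1 Gy2] [].
  by move=> /(injmP injf)-> // /(injmP injg)->.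
apply/setP=> Z; apply/imsetP/imset2P.
  case=> _ /imset2P[X1 X2 AX1 AX2 ->] ->.
  exists (f @* X1) (g @* X2); rewrite ?imset_f //.
  by rewrite hX ?sA1 ?sA2.
case=> _ _ /imsetP[X1 AX1 ->] /imsetP[X2 AX2 ->] ->.
exists (setX X1 X2); first exact: imset2_f.
by rewrite hX ?sA1 ?sA2.
Qed.

(** * Basic sets, unions of basic sets and their products *)

Section SringTheory.
Import GRing.Theory Num.Theory.
Variables (gT : finGroupType) (G : {group gT}) (A : {set {set gT}}).
Hypothesis sA : Sring G A.
Implicit Types (D X Y Z : {set gT}) (S T : section gT).

(** Elementwise form of being a union of basic sets: a basic set that meets [D] lies in it. Unlike
    [Agroup], it applies to arbitrary subsets, such as products. *)
Definition Aset D :=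
  D \subset G /\ {in A, forall X x, x \in X -> x \in D -> X \subset D}.

Lemma basic_sub X : X \in A -> X \subset G.
Proof.
by case: sA => /and3P[/eqP <- _ _] _ _ _; apply: bigcup_sup.
Qed.

Lemma basic_ex x : x \in G -> exists2 X, X \in A & x \in X.
Proof.
by case: sA => /and3P[/eqP <- _ _] _ _ _ /bigcupP[X AX Xx]; exists X.
Qed.

Lemma basic_neq0 X : X \in A -> exists x, x \in X.
Proof.
case: sA => /and3P[_ _ A0] _ _ _ AX; apply/set0Pn.
by apply: contraNneq A0 => <-.
Qed.

Lemma basic_eq X Y x : X \in A -> Y \in A -> x \in X -> x \in Y -> X = Y.
Proof.
case: sA => /and3P[_ tA _] _ _ _ AX AY Xx Yx.
by rewrite -(def_pblock tA AX Xx) (def_pblock tA AY Yx).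
Qed.

Lemma basic_Aset X : X \in A -> Aset X.
Proof.
move=> AX; split=> [|Y AY x Yx Xx]; first exact: basic_sub.
by rewrite (basic_eq _ _ x AY AX).
Qed.

Lemma Agroup_Aset (U : {group gT}) : Agroup A U -> Aset U.
Proof.
case=> B sBA ->; split=> [|X AX x Xx /bigcupP[Y BY Yx]].
  by apply/bigcupsP=> X BX; apply/basic_sub/(subsetP sBA).
rewrite (basic_eq _ _ x AX (subsetP sBA _ BY)) //.
exact: bigcup_sup.
Qed.

Lemma span_coef (c : {set gT} -> int) X x : X \in A -> x \in X ->
  (\sum_(Y in A) set_sum Y *~ c Y)%R x = c X.
Proof.
move=> AX Xx; rewrite sum_ffunE (bigD1 X) //= big1 => [|Y /andP[AY nYX]].
  by rewrite addr0 ffunMzE !ffunE Xx intz.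
rewrite ffunMzE ffunE.
case: (boolP (x \in Y)) => [Yx | _]; last by rewrite mul0rz.
by rewrite (basic_eq _ _ x AY AX) ?eqxx in nYX.
Qed.

Lemma set_sum_span D : Aset D ->
  set_sum D = (\sum_(X in A) set_sum X *~ (X \subset D)%:R)%R.
Proof.
case=> sDG AD; apply/ffunP=> x; rewrite ffunE.
case: (boolP (x \in G)) => [/basic_ex[X AX Xx] | nGx].
  rewrite (span_coef (fun Y => (Y \subset D)%:R)%R X) //.
  case: (boolP (x \in D)) => [Dx | nDx]; first by rewrite (AD X AX x).
  by case: subsetP => // /(_ x Xx); rewrite (negPf nDx).
rewrite sum_ffunE big1 => [|X AX].
  by rewrite (contraNF (subsetP sDG x)).
by rewrite ffunMzE ffunE (contraNF (subsetP (basic_sub _ AX) x)) // mul0rz.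
Qed.

(** The coefficient at [z] counts the factorizations of [z] in [D1 * D2]. Its terms are nonnegative,
    so no cancellation can hide one. *)
Lemma set_sum_mul_eq0 D1 D2 z :
  ((set_sum D1 * set_sum D2)%R z == 0%R) = (z \notin D1 * D2).
Proof.
rewrite [(_ * _)%R]/(zgring_mul _ _) ffunE.
under eq_bigr => x _ do rewrite !ffunE -natrM mulnb.
rewrite psumr_eq0 //; apply/allP/idP => [D0 | nDz x _].
  apply/mulsgP=> [[x y D1x D2y defz]].
  by have := D0 x (mem_index_enum _); rewrite defz mulKg D1x D2y.
rewrite pnatr_eq0 eqb0; apply: contra nDz => /andP[D1x D2x].
by rewrite -(mulKVg x z) mem_mulg.
Qed.

Lemma Aset_mul D1 D2 : Aset D1 -> Aset D2 -> Aset (D1 * D2).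
Proof.
move=> AD1 AD2; split=> [|X AX x Xx Dx].
  by apply: mul_subG; [case: AD1 | case: AD2].
have [_ _ _ [B [_ _ BM] spanB]] := sA.
have [c defM] : exists c : {set gT} -> int,
    (set_sum D1 * set_sum D2)%R = (\sum_(X in A) set_sum X *~ c X)%R.
  by apply/spanB/BM; apply/spanB; eexists; apply: set_sum_span.
(* Both [x] and [y] lie in [X], so their coefficients equal [c X]; if one vanishes, so does the
   other. *)
apply/subsetP=> y Xy; apply: contraLR Dx.
by rewrite -!set_sum_mul_eq0 defM !(span_coef c X).
Qed.

Lemma basic_mul_sub L X Y x : Aset L -> X \in A -> Y \in A ->
  x \in X -> x \in Y * L -> X \subset Y * L.
Proof.
move=> AL AX AY Xx YLx.
have [_ AYL] := Aset_mul _ _ (basic_Aset _ AY) AL.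
exact: AYL YLx.
Qed.

(** One shared coset of [L] suffices: [Y * L] and [X * L] are unions of basic sets, so each of [X],
    [Y] is absorbed whole into the product of the other with [L]. *)
Lemma quotient_basic_eq (L : {group gT}) X Y x y : Agroup A L ->
  X \in A -> Y \in A -> x \in X -> y \in Y -> x \in y *: L ->
  X / L = Y / L.
Proof.
move=> /Agroup_Aset AL AX AY Xx Yy yLx.
have YLx : x \in Y * L by apply: subsetP yLx; rewrite mulSg ?sub1set.
have XLy : y \in X * L.
  by rewrite lcoset_sym in yLx; apply: subsetP yLx; rewrite mulSg ?sub1set.
have subL Z1 Z2 : Z1 \subset Z2 * L -> Z1 / L \subset Z2 / L.
  by move=> sZ; rewrite -(quotientMidr L Z2) quotientS.
by apply/eqP; rewrite eqEsubset !subL //; apply: basic_mul_sub AL _ _ _ _; eauto.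
Qed.

(** * Projectively equivalent sections *)

Lemma proj_step_Cayley S T : proj_step A S T ->
  Cayley_isomorphic (section_group S) (restr A S) (section_group T) (restr A T).
Proof.
case: S T => [[U1 L1]] [[U2 L2]] [[/= AU1 _ _] [/= AU2 AL2 nL2U2] defL1 defU2].
have sU12 : U1 \subset U2 by rewrite -defU2 mulG_subl.
have nL2U1 : U1 \subset 'N(L2) := subset_trans sU12 (normal_norm nL2U2).
(* The quotient type depends on [L1], so it is replaced by the very group that occurs in
   [second_isom]. *)
have{defL1} -> : L1 = (L2 :&: U1)%G by apply: val_inj; rewrite /= setIC.
have [f injf defim] := second_isom nL2U1.
exists f.
  apply/isomP; split=> //=; rewrite /= defim //.
  by rewrite -(quotientMidr L2 U1) defU2.
apply/setP=> Z; apply/imsetP/imsetP.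
  case=> _ /imsetP[X /setIdP[AX sXU1] ->] ->; exists X.
    by rewrite inE AX (subset_trans sXU1).
  exact: defim.
case=> Y /setIdP[AY sYU2] ->; have [y Yy] := basic_neq0 _ AY.
(* The basic set of the [U1]-component of [y] is the preimage sought: it stays inside [U1] and meets
   the coset of [y] modulo [L2]. *)
have : y \in U1 * L2 by rewrite defU2 (subsetP sYU2).
case/mulsgP=> u l U1u L2l defy.
have [sU1G AU1'] := Agroup_Aset _ AU1.
have [X AX Xu] := basic_ex u (subsetP sU1G u U1u).
have sXU1 : X \subset U1 by apply: AU1' U1u.
exists (X / (L2 :&: U1)); first by apply/imsetP; exists X; rewrite ?inE ?AX.
rewrite defim //.
apply: (quotient_basic_eq _ _ _ y u) => //.
by rewrite defy mem_lcoset mulKg.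
Qed.

Lemma restr_sub S :
  {in restr A S, forall X : {set coset_of S.2}, X \subset section_group S}.
Proof. by move=> _ /imsetP[X /setIdP[_ sXS] ->]; apply: quotientS. Qed.

Lemma proj_equiv_Cayley S T : proj_equiv A S T ->
  Cayley_isomorphic (section_group S) (restr A S) (section_group T) (restr A T).
Proof.
elim=> {S T} [S T | S | S T _ IH | S T U _ IH1 _ IH2].
- exact: proj_step_Cayley.
- exists (idm_morphism (section_group S)).
    by apply/isomP; rewrite injm_idm im_idm.
  rewrite -[RHS]imset_id; apply: eq_in_imset => X AX.
  by rewrite morphim_idm //; apply: restr_sub.
- by apply: Cayley_sym => //; apply: restr_sub.
exact: Cayley_trans IH1 IH2.
Qed.

(** * Splitting off a discrete direct factor *)

Definition basic_in (U : {group gT}) := [set X in A | X \subset U].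

Lemma basic_in_sub U : {in basic_in U, forall X, X \subset U}.
Proof. by move=> X /setIdP[]. Qed.

(** Trades the section [U / 1] for basic sets in [gT] itself, where they can be multiplied inside
    [G]. *)
Lemma basic_in_quotient1 (U : {group gT}) :
  Cayley_isomorphic U (basic_in U)
    (section_group (U / 1)%sec) (restr A (U / 1)%sec).
Proof.
exists (restrm_morphism (norms1 U) (coset_morphism 1)) => /=.
  exact: quotient1_isom.
apply: eq_in_imset => X /setIdP[_ sXU].
by rewrite morphim_restrm (setIidPr sXU).
Qed.

(** A basic set [Y] meeting [k X] lies in it. Since [k^-1] is a basic singleton too, the same
    argument puts [X] inside [k^-1 Y], which forces equality. *)
Lemma basic_lmul k X : [set k] \in A -> X \in A -> [set k] * X \in A.
Proof.
move=> Ak AX; have [x Xx] := basic_neq0 _ AX.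
have AkV : [set k^-1] \in A.
  by case: sA => _ _ /(_ _ Ak); rewrite invg_set1.
have [skXG AkX] := Aset_mul _ _ (basic_Aset _ Ak) (basic_Aset _ AX).
have kXx : k * x \in [set k] * X by rewrite mem_mulg ?set11.
have [Y AY Ykx] := basic_ex _ (subsetP skXG _ kXx).
suff <- : Y = [set k] * X by [].
apply/eqP; rewrite eqEsubset (AkX Y AY _ Ykx kXx) /=.
have [_ AkY] := Aset_mul _ _ (basic_Aset _ AkV) (basic_Aset _ AY).
have kYx : x \in [set k^-1] * Y by rewrite -(mulKg k x) mem_mulg ?set11.
have := mulgS [set k] (AkY X AX x Xx kYx).
by rewrite mulgA mulg_set1 mulgV mul1g.
Qed.

Lemma discrete_dprod_Cayley (K H : {group gT}) :
    Agroup A K -> Agroup A H -> K \x H = G -> discrete (basic_in K) ->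
  Cayley_isomorphic (setX_group K H) (tensor (basic_in K) (basic_in H)) G A.
Proof.
move=> AK AH defG dK.
have /misomP[fM isof] : misom (setX K H) G mulgm by apply/mulgmP.
have [_ defKH _ _] := dprodP defG.
exists (morphm_morphism fM) => //=.
have imX X Y : X \subset K -> Y \subset H -> morphm fM @* setX X Y = X * Y.
  move=> sXK sYH; rewrite morphimEsub ?setXS //.
  apply/setP=> z; apply/imsetP/mulsgP.
    by case=> [[x y] /setXP[Xx Yy] ->]; exists x y.
  by case=> x y Xx Yy ->; exists (x, y) => //; apply/setXP.
apply/setP=> Z; apply/imsetP/idP.
  case=> _ /imset2P[X Y KX HY ->] ->.
  rewrite imX ?basic_in_sub //; have [x defX] := dK X KX.
  by rewrite defX basic_lmul // -?defX; [case/setIdP: KX | case/setIdP: HY].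
(* Writing a point of [Z] as [k * h], translation by [k^-1] carries [Z] to a basic set containing
   [h], hence contained in [H]. *)
move=> AZ; have [z Zz] := basic_neq0 _ AZ.
have := subsetP (basic_sub _ AZ) z Zz; rewrite -defKH => /mulsgP[k h Kk Hh defz].
have [[sKG AK'] [_ AH']] := (Agroup_Aset _ AK, Agroup_Aset _ AH).
have basic1 x : x \in K -> [set x] \in basic_in K.
  move=> Kx; have [X AX Xx] := basic_ex _ (subsetP sKG x Kx).
  have KX : X \in basic_in K by rewrite inE AX (AK' X AX x).
  by have [y defX] := dK X KX; move: Xx; rewrite defX => /set1P->; rewrite -defX.
have AkZ : [set k^-1] * Z \in A.
  by apply: basic_lmul => //; case/setIdP: (basic1 k^-1 (groupVr Kk)).
have kZh : h \in [set k^-1] * Z by rewrite -(mulKg k h) -defz mem_mulg ?set11.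
have HkZ : [set k^-1] * Z \in basic_in H by rewrite inE AkZ (AH' _ AkZ h).
exists (setX [set k] ([set k^-1] * Z)); first exact: imset2_f (basic1 k Kk) HkZ.
rewrite imX ?sub1set //; last exact: basic_in_sub.
by rewrite mulgA mulg_set1 mulgV mul1g.
Qed.

Lemma Agroup_full : Agroup A G.
Proof. by exists A => //; case: sA => /and3P[/eqP-> _ _]. Qed.

Lemma Agroup1 : Agroup A 1%G.
Proof.
exists [set [set 1]]; first by rewrite sub1set; case: sA.
by rewrite /cover big_set1.
Qed.

Lemma Asection1 (U : {group gT}) : Agroup A U -> Asection A (U / 1)%sec.
Proof. by move=> AU; split=> //=; [exact: Agroup1 | exact: normal1]. Qed.

End SringTheory.

Theorem theorem7p1 (gT : finGroupType) (G : {group gT}) (A : {set {set gT}})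
    (H : {group gT}) (S : section gT) :
  cyclic G -> Sring G A -> Agroup A H ->
  (exists K : {group gT}, Acomplement G A H K) ->
  Asection A S -> proj_equiv A S (G / H)%sec -> discrete (restr A S) ->
  forall T : section gT,
    Asection A T -> proj_equiv A T (H / 1)%sec ->
    Cayley_isomorphic G A
      (setX_group (section_group S) (section_group T))
      (tensor (restr A S) (restr A T)).
Proof.
move=> _ sA AH [K [AK defG]] _ eqS dS T _ eqT.
have nsHG : H <| G by have [] := dprod_normal2 defG.
have [_ defHK _ tiHK] := dprodP defG.
(* The two conditions on the step are exactly that [K] and [H] meet trivially and generate [G] as a
   product. *)
have stepK : proj_step A (K / 1)%sec (G / H)%sec.
  split=> /=; [exact: Asection1 _ _ _ sA _ AK | split=> // | by rewrite setIC |].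
    exact: Agroup_full _ _ _ sA.
  by rewrite -defHK; case/dprodP: defG => _ _ /centC.
have isoS : Cayley_isomorphic (section_group S) (restr A S)
    K (basic_in gT A K).
  apply: (Cayley_trans _ _ _ _ _ (section_group (K / 1)%sec)
            (restr A (K / 1)%sec)).
    apply: (proj_equiv_Cayley _ _ _ sA).
    by apply: rst_trans eqS _; apply/rst_sym/rst_step.
  apply: Cayley_sym (basic_in_quotient1 _ _ _); exact: basic_in_sub.
have isoT : Cayley_isomorphic (section_group T) (restr A T)
    H (basic_in gT A H).
  apply: Cayley_trans (proj_equiv_Cayley _ _ _ sA _ _ eqT) _.
  apply: Cayley_sym (basic_in_quotient1 _ _ _); exact: basic_in_sub.
have dK := Cayley_discrete _ _ _ _ _ _ (restr_sub _ _ _) isoS dS.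
(* The isomorphism is built from the tensor product towards [G], the direction of the multiplication
   map. *)
apply: Cayley_sym.
  by move=> _ /imset2P[X Y AX AY ->]; rewrite setXS ?(restr_sub gT A).
apply: Cayley_trans (Cayley_tensor _ _ _ _ _ _ _ _ _ _ _ _ _ _ isoS isoT) _.
- exact: restr_sub.
- exact: restr_sub.
by apply: discrete_dprod_Cayley => //; rewrite dprodC.
Qed.
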